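(* For every $\alpha\in(0,1)$, every randomized online algorithm for non-clairvoyant dynamic bin packing that makes at most $\alpha n$ migrations in expectation on every instance with $n$ items has competitive ratio at least $\frac14\left\lfloor \frac{1}{4\alpha}\right\rfloor$ with respect to the total active time objective.
   Context: Dynamic bin packing: bins have capacity $1$. Items $i=1,\dots,n$ arrive online at times $a_i\ge0$ with size $s_i\in[0,1]$ and duration $d_i>0$; item $i$ is present during $[a_i,a_i+d_i)$. Non-clairvoyant: at arrival only the size is revealed, not the duration. On arrival the item must be placed into an open bin with enough remaining capacity, or into a newly opened bin. A migration moves an already placed item to another bin; migrations are counted by number of moves. A bin is open while it contains an item. The cost (total active time) of an algorithm on instance $I$ is $\int_0^\infty (\text{number of open bins at time } t)\,dt$. $\mathrm{OPT}(I)=\int_0^\infty \mathrm{OPT}_t\,dt$, where $\mathrm{OPT}_t$ is the minimum number of unit bins needed to pack the items present at time $t$ (the optimal offline policy that knows the instance and may repack arbitrarily at any time). A randomized algorithm has competitive ratio at least $\gamma$ if for every $\beta<\gamma$ there is an instance $I$ with $\mathbb{E}[\mathrm{cost}(I)] > \beta\,\mathrm{OPT}(I)$. *)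

(* Defs.v *)
From HB Require Import structures.
From mathcomp Require Import all_boot all_order all_algebra.
From mathcomp Require Import all_classical all_reals all_analysis.
From mathcomp Require Import measurable_realfun.
Set Implicit Arguments. Unset Strict Implicit. Unset Printing Implicit Defensive.
Import Order.TTheory GRing.Theory Num.Theory.
Local Open Scope ring_scope.
Local Open Scope classical_set_scope.

Section DynamicBinPacking.
Variable R : realType.

Record item := Item { arr : R; sz : R; dur : R }.

(* An instance: items listed in arrival order (item i is the i-th to arrive). *)
Definition instance := seq item.

Definition it (I : instance) (i : nat) : item := nth (Item 0 0 1) I i.

Definition valid_instance (I : instance) : Prop :=
  (forall i, (i < size I)%N ->
     0 <= arr (it I i) /\ 0 <= sz (it I i) <= 1 /\ 0 < dur (it I i)) /\
  (forall i j, (i <= j)%N -> (j < size I)%N -> arr (it I i) <= arr (it I j)).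

Definition present (I : instance) (t : R) (i : nat) : bool :=
  [&& (i < size I)%N, arr (it I i) <= t & t < arr (it I i) + dur (it I i)].

(* A configuration assigns a bin label to every item (only the labels of
   present items matter). *)
Definition config := nat -> nat.

(* A trajectory: list of breakpoints (t_k, c_k); configuration c_k is in
   force on [t_k, t_{k+1}) (the last one forever). *)
Definition traj := seq (R * config).

Definition bp0 : R * config := (0, fun _ => 0%N).

Definition config_at (tr : traj) (t : R) : config :=
  last (fun _ => 0%N) [seq p.2 | p <- tr & p.1 <= t].

Definition nbins (I : instance) (tr : traj) (t : R) : nat :=
  size (undup [seq config_at tr t i | i <- iota 0 (size I) & present I t i]).

Definition bin_load (I : instance) (c : config) (t : R) (b : nat) : R :=
  \sum_(i <- iota 0 (size I) | present I t i && (c i == b)) sz (it I i).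

Definition valid_traj (I : instance) (tr : traj) : Prop :=
  [/\ tr <> [::],
      (head bp0 tr).1 = 0,
      (forall k, (k.+1 < size tr)%N ->
         (nth bp0 tr k).1 < (nth bp0 tr k.+1).1) &
      (forall t b, bin_load I (config_at tr t) t b <= 1)].

(* Number of migrations: at breakpoint t_{k+1}, every item present just
   before and at t_{k+1} whose bin changes counts as one move. *)
Definition mig_step (I : instance) (tr : traj) (k : nat) : nat :=
  let t := (nth bp0 tr k.+1).1 in
  let c := (nth bp0 tr k).2 in
  let c' := (nth bp0 tr k.+1).2 in
  count (fun i => [&& arr (it I i) < t, t < arr (it I i) + dur (it I i)
                    & c i != c' i]) (iota 0 (size I)).

Definition migrations (I : instance) (tr : traj) : nat :=
  (\sum_(k < (size tr).-1) mig_step I tr k)%N.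

Definition cost (I : instance) (tr : traj) : \bar R :=
  (\int[lebesgue_measure]_(t in [set: R]) ((nbins I tr t)%:R)%:E)%E.

Definition packable (I : instance) (t : R) (k : nat) : Prop :=
  exists f : config,
    (forall i, present I t i -> (f i < k)%N) /\
    (forall b, bin_load I f t b <= 1).

Definition opt_at (I : instance) (t : R) : nat :=
  \big[minn/size I]_(k < (size I).+1 | `[< packable I t k >]) (k : nat).

Definition OPT (I : instance) : \bar R :=
  (\int[lebesgue_measure]_(t in [set: R]) ((opt_at I t)%:R)%:E)%E.

(* The information revealed up to time t (non-clairvoyant, online):
   which items have arrived, their arrival times and sizes, and, for those
   already departed, their departure times. *)
Definition arrived (I : instance) (t : R) (i : nat) : bool :=
  (i < size I)%N && (arr (it I i) <= t).

Definition same_info (I J : instance) (t : R) : Prop :=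
  forall i, arrived I t i = arrived J t i /\
    (arrived I t i ->
       [/\ arr (it I i) = arr (it J i), sz (it I i) = sz (it J i),
           (arr (it I i) + dur (it I i) <= t) =
             (arr (it J i) + dur (it J i) <= t) &
           (arr (it I i) + dur (it I i) <= t -> dur (it I i) = dur (it J i))]).

Record online_alg := OnlineAlg {
  run : instance -> traj;
  run_valid : forall I, valid_instance I -> valid_traj I (run I);
  run_online : forall I J t, valid_instance I -> valid_instance J ->
    same_info I J t ->
    forall i, present I t i -> config_at (run I) t i = config_at (run J) t i
}.

(* A randomized algorithm: a random seed w drawn from a probability space,
   and a deterministic online algorithm A w for each seed. *)
Section Randomized.
Context {d : measure_display} {Omega : measurableType d}
  (P : probability Omega R) (A : Omega -> online_alg).

Definition rand_measurable : Prop :=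
  forall I, valid_instance I ->
    measurable_fun [set: Omega] ((fun w => cost I (run (A w) I)) : Omega -> \bar R) /\
    measurable_fun [set: Omega] (fun w => ((migrations I (run (A w) I))%:R : R)).

Definition E_cost (I : instance) : \bar R :=
  (\int[P]_(w in [set: Omega]) cost I (run (A w) I))%E.

Definition E_mig (I : instance) : \bar R :=
  (\int[P]_(w in [set: Omega]) ((migrations I (run (A w) I))%:R)%:E)%E.

Definition competitive_ratio_at_least (gamma : R) : Prop :=
  forall beta : R, beta < gamma ->
    exists I, valid_instance I /\ (beta%:E * OPT I < E_cost I)%E.

End Randomized.
End DynamicBinPacking.

(* Main.v *)
(** Let [M = floor (1 / (4 alpha))], raised to [1] if it is [0].  At time [0],
    [M^2] items of size [1/M] arrive; a random word [s] of [M] of them lasts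
    until time [1 + L], the others leave at time [1].  Until time [1] the
    algorithm learns nothing about [s], so its initial packing, whose bins hold
    at most [M] items, is independent of [s]; two letters of [s] share a bin
    with probability at most [1/M], hence [s] meets at least
    [M - (M - 1) / 2 = (M + 1) / 2] initial bins in expectation.  Each migration
    saves at most one of them, and at most [alpha * M^2 <= M / 4] migrations are
    made, so the cost is at least [L * (M / 4 + 1 / 2)], whereas the optimum is
    at most [M + L].  Taking [L = M^2] suffices.  As the number of initial bins
    need not be measurable in the seed, the bound
    [L * bins <= cost + L * migrations] is summed over all words [s] pointwise
    in the seed, and only then integrated. *)

Require Import Defs.
From HB Require Import structures.
From mathcomp Require Import all_boot all_order all_algebra.
From mathcomp Require Import all_classical all_reals all_analysis.
From mathcomp Require Import measurable_realfun.
From mathcomp Require Import zify lra.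
Import Order.TTheory GRing.Theory Num.Theory.
Local Open Scope ring_scope.

Set Implicit Arguments.
Unset Strict Implicit.
Unset Printing Implicit Defensive.

(** * Counting distinct values of a map *)

(** Each value of [f] on [s] is a value of [g] on [r] or is taken where the maps disagree. Here [f]
    will be the initial packing and [g] a later one. *)
Lemma size_undup_map_le (T U : eqType) (f g : T -> U) (s r : seq T) :
  {subset s <= r} ->
  (size (undup (map f s)) <=
     size (undup (map g r)) + count (fun x => f x != g x) r)%N.
Proof.
move=> sr; rewrite -size_filter -(size_map f) -size_cat.
apply: uniq_leq_size; first exact: undup_uniq.
move=> y; rewrite mem_undup => /mapP[x xs ->]; rewrite mem_cat mem_undup.
case: (eqVneq (f x) (g x)) => [->|fg]; first by rewrite map_f// sr.
by apply/orP; right; apply: map_f; rewrite mem_filter fg sr.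
Qed.

(** A union bound, later taken over the breakpoints of a trajectory. *)
Lemma count_le_sum (T : eqType) (n : nat) (a : pred T) (p : 'I_n -> pred T)
    (s : seq T) :
  {in s, forall x, a x -> exists k, p k x} ->
  (count a s <= \sum_(k < n) count (p k) s)%N.
Proof.
elim: s => [|x s IH] aP /=; first by rewrite leq0n.
rewrite big_split /= leq_add//; last first.
  by apply: IH => y ys; apply: aP; rewrite inE ys orbT.
case: (boolP (a x)) => // /aP[|k pk]; first exact: mem_head.
by rewrite (bigD1 k)//= pk.
Qed.

(** * Bins met by a random word *)

(** Letters may repeat, so a uniform word is a sequence of independent draws and sums over words
    obey a recursion in [k]. *)
Fixpoint words (n k : nat) : seq (seq nat) :=
  if k is k'.+1 then [seq x :: s | s <- words n k', x <- iota 0 n]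
  else [:: [::]].

Lemma size_words (n k : nat) : size (words n k) = (n ^ k)%N.
Proof. by elim: k => //= k IH; rewrite size_allpairs IH size_iota expnSr. Qed.

Lemma words_spec (n k : nat) (s : seq nat) :
  s \in words n k -> size s = k /\ {subset s <= iota 0 n}.
Proof.
elim: k s => [|k IH] s /=; first by rewrite inE => /eqP->.
case/allpairsP => -[u x] /= [/IH[<- uI] xI ->]; split=> // y.
by rewrite inE => /predU1P[->//|/uI].
Qed.

Section Words.
Variables (M : nat) (c : nat -> nat).
Hypothesis cap :
  forall b, (count (fun i => c i == b) (iota 0 (M * M)) <= M)%N.

Lemma count_hit (s : seq nat) :
  (count (fun x => c x \in map c s) (iota 0 (M * M)) <= M * size s)%N.
Proof.
elim: s => [|y s IH]; first by rewrite count_pred0.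
rewrite mulnS (leq_trans _ (leq_add (cap (c y)) IH))//.
by rewrite -count_predUI leq_addr.
Qed.

(** After division by [M * M]: a fresh uniform letter falls in a bin already met with probability at
    most [size s / M]. *)
Lemma sum_undup_step (s : seq nat) :
  (M * M * size (undup (map c s)) + M * M <=
   \sum_(x <- iota 0 (M * M)) size (undup (map c (x :: s))) + M * size s)%N.
Proof.
have E x : size (undup (map c (x :: s))) =
   (size (undup (map c s)) + ~~ (c x \in map c s))%N.
  by rewrite /=; case: ifP; rewrite ?addn0 ?addn1.
under eq_bigr do rewrite E.
rewrite big_split /= big_const_seq count_predT size_iota iter_addn addn0.
rewrite [X in (_ <= _ + X + _)%N](_ : _ =
   count (predC (fun x => c x \in map c s)) (iota 0 (M * M))); last first.
  by rewrite -sum1_count [RHS]big_mkcond; apply: eq_bigr => x _ /=; case: ifP.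
have := count_predC (fun x => c x \in map c s) (iota 0 (M * M)).
rewrite size_iota; have := count_hit s; lia.
Qed.

(** The gains [1 - j / M] are added over [j < k], and all is scaled by [2 * M * (M * M) ^ k] to stay
    in the natural numbers. *)
Lemma sum_undup_words (k : nat) :
  (2 * M * k * (M * M) ^ k <=
   2 * M * (\sum_(s <- words (M * M) k) size (undup (map c s)))
   + k * k.-1 * (M * M) ^ k)%N.
Proof.
elim: k => [|k IH]; first by rewrite muln0.
rewrite /= big_allpairs_dep /=.
have : (\sum_(s <- words (M * M) k)
   (M * M * size (undup (map c s)) + M * M) <=
   \sum_(s <- words (M * M) k)
     (\sum_(x <- iota 0 (M * M)) size (undup (map c (x :: s))) + M * k))%N.
  rewrite !big_seq; apply: leq_sum => s /words_spec[<- _].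
  exact: sum_undup_step.
rewrite !big_split /= -big_distrr /= !big_const_seq !count_predT !size_words.
rewrite !iter_addn !addn0 expnS.
set T := (\sum_(s <- words _ _) size _)%N in IH *.
set U := (\sum_(s <- words _ _) \sum_(x <- _) _)%N.
set e := ((M * M) ^ k)%N in IH *; clearbody T U e.
case: k IH => [|k] /= IH H; nia.
Qed.

End Words.

Lemma double_sum_undup_words (M : nat) (c : nat -> nat) : (0 < M)%N ->
  (forall b, (count (fun i => c i == b) (iota 0 (M * M)) <= M)%N) ->
  ((M * M) ^ M * M.+1 <=
   2 * \sum_(s <- words (M * M) M) size (undup (map c s)))%N.
Proof.
move=> M0 /sum_undup_words/(_ M).
set e := ((M * M) ^ M)%N; set T := (\sum_(s <- _) _)%N; clearbody e T.
case: M M0 => // m _ /= H; rewrite -(leq_pmul2l (ltn0Sn m)); nia.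
Qed.

(** * Packings along a trajectory *)

Section Trajectories.
Context {R : realType}.
Implicit Types (I : instance R) (tr s : traj R) (t : R) (i : nat).

Lemma config_at_head p s : path (fun x y => x.1 < y.1) p s ->
  config_at (p :: s) p.1 = p.2.
Proof.
move=> /order_path_min ps; rewrite /config_at /= lexx /=.
rewrite (@eq_in_filter _ _ pred0) ?filter_pred0// => q qs /=.
by rewrite leNgt (allP (ps _) q qs)// => x y z; exact: lt_trans.
Qed.

(** Either the first step already changes the bin of [i], or the search restarts from the second
    breakpoint. Entry [k] of [s] is entry [k.+1] of [p :: s], the indexing of [mig_step]. *)
Lemma config_at_change p s t i :
  path (fun x y => x.1 < y.1) p s -> p.1 <= t ->
  config_at (p :: s) t i != p.2 i ->
  exists2 k, (k < size s)%N &
    [/\ p.1 < (nth (bp0 R) s k).1, (nth (bp0 R) s k).1 <= t &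
        (nth (bp0 R) (p :: s) k).2 i != (nth (bp0 R) s k).2 i].
Proof.
elim: s p => [|q s IH] p ps pt.
  by rewrite /config_at /= pt /= eqxx.
move: (ps) => /= /andP[pq qs].
have [qt|tq] := leP q.1 t; last first.
  rewrite /config_at /= pt leNgt tq /=.
  rewrite (@eq_in_filter _ _ pred0) ?filter_pred0 ?eqxx// => x xs /=.
  rewrite leNgt (lt_trans tq)//.
  have /allP := order_path_min (fun _ _ _ => @lt_trans _ _ _ _ _) qs.
  exact.
have -> : config_at [:: p, q & s] t = config_at (q :: s) t.
  by rewrite /config_at /= pt qt.
have [pqi|pqi _] := eqVneq (p.2 i) (q.2 i); last by exists 0%N.
rewrite pqi => /(IH _ qs qt)[k ks [k1 k2 k3]].
by exists k.+1 => //; split=> //; exact: lt_trans k1.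
Qed.

Lemma valid_traj_cons I tr : valid_traj I tr -> exists p s,
  [/\ tr = p :: s, p.1 = 0 & path (fun x y : R * config => x.1 < y.1) p s].
Proof.
case: tr => [[]//|p s] [_ /= p0 tr_sorted _]; exists p, s; split=> //.
by apply/(pathP (bp0 R)) => k ks; exact: (tr_sorted k).
Qed.

(* A present item whose bin at time [t] differs from its bin at time [0] has
   been migrated at least once. *)
Lemma size_undup_config0_le I tr t (r : seq nat) : valid_traj I tr ->
  0 <= t -> (forall i, (i < size I)%N -> arr (it I i) = 0) ->
  {subset r <= [seq i <- iota 0 (size I) | present I t i]} ->
  (size (undup (map (config_at tr 0) r)) <= nbins I tr t + migrations I tr)%N.
Proof.
move=> /valid_traj_cons[p [s [-> p0 ps]]] t0 arr0 rI.
apply: leq_trans (size_undup_map_le _ (config_at (p :: s) t) rI) _.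
rewrite leq_add2l count_filter; apply: count_le_sum => i.
rewrite mem_iota add0n => /= iI /andP[+ /and3P[_ _ ti]].
rewrite eq_sym -p0 config_at_head// => /config_at_change.
rewrite p0 => /(_ ps t0)[k ks [k1 k2 k3]].
(* The breakpoint lies after time 0 and no later than [t], when the item is still present, so
   [mig_step] counts this change. *)
exists (Ordinal ks) => /=.
rewrite arr0// k1 k3 andbT add0r /=.
by rewrite arr0// add0r in ti; exact: le_lt_trans ti.
Qed.

End Trajectories.

(** * Integrals and the optimum *)

(* Unlike [ge0_le_integral], this applies to integrands not known to be
   measurable, such as [nbins I tr]: the integral of a nonnegative function is a
   supremum over the simple functions below it. *)
Lemma le_ge0_integralT d (T : measurableType d) (R : realType)
    (mu : {measure set T -> \bar R}) (f g : T -> \bar R) :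
  (forall x, 0 <= f x)%E -> (forall x, f x <= g x)%E ->
  (\int[mu]_x f x <= \int[mu]_x g x)%E.
Proof.
move=> f0 fg; have g0 x : (0 <= g x)%E by exact: le_trans (fg x).
rewrite !ge0_integralTE//; apply: ereal_sup_le => _ [h hf <-].
by exists h => // x; exact: le_trans (fg x).
Qed.

Lemma integral_step (R : realType) (a b k : R) : a <= b -> 0 <= k ->
  (\int[lebesgue_measure]_(t in [set: R]) (k * \1_(`[a, b[%classic) t)%:E =
   (k * (b - a))%:E)%E.
Proof.
move=> ab k0; under eq_integral do rewrite EFinM.
rewrite ge0_integralZl_EFin//; last first.
  by apply/measurable_EFinP; exact: measurable_indic.
rewrite integral_indic//= classical_sets.setIT lebesgue_measure_itv/= lte_fin.
move: ab; rewrite le_eqVlt => /predU1P[->|->]; last by rewrite EFinM EFinB.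
by rewrite ltxx subrr mulr0 mule0.
Qed.

Lemma opt_at_le (R : realType) (I : instance R) (t : R) (k : nat) :
  packable I t k -> (k <= size I)%N -> (opt_at I t <= k)%N.
Proof.
move=> pk kI; rewrite /opt_at.
have : Ordinal (kI : (k < (size I).+1)%N) \in index_enum 'I_(size I).+1.
  by rewrite mem_index_enum.
elim: (index_enum _) => // x r IH; rewrite inE big_cons => /predU1P[<-|xr].
  by rewrite (asboolT pk) geq_minl.
by case: ifP => _; [rewrite geq_min IH ?orbT | exact: IH].
Qed.

(** * The hard instances *)

Section HardInstance.
Context {R : realType}.
Variables (M : nat) (L : R).
Hypotheses (M_gt0 : (0 < M)%N) (L_ge0 : 0 <= L).

Definition hard_instance (s : seq nat) : instance R :=
  mkseq (fun i => Item 0 M%:R^-1 (if i \in s then 1 + L else 1)) (M * M).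

Lemma size_hard_instance s : size (hard_instance s) = (M * M)%N.
Proof. exact: size_mkseq. Qed.

Lemma it_hard_instance s i : (i < M * M)%N ->
  it (hard_instance s) i = Item 0 M%:R^-1 (if i \in s then 1 + L else 1).
Proof. exact: nth_mkseq. Qed.

Lemma hard_dur_gt0 (s : seq nat) i : 0 < (if i \in s then 1 + L else 1).
Proof. by case: ifP => // _; rewrite ltr_wpDr. Qed.

Lemma hard_instance_valid s : valid_instance (hard_instance s).
Proof.
split=> [i|i j ij]; rewrite size_hard_instance => iM.
  rewrite it_hard_instance//= hard_dur_gt0 lexx invr_ge0 ler0n.
  by rewrite invf_le1 ?ler1n ?ltr0n.
by rewrite !it_hard_instance//; exact: leq_ltn_trans iM.
Qed.

Lemma present_hard_instance s t i : present (hard_instance s) t i =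
  [&& (i < M * M)%N, 0 <= t & t < if i \in s then 1 + L else 1].
Proof.
rewrite /present size_hard_instance; case: ltnP => //= iM.
by rewrite it_hard_instance//= add0r.
Qed.

Lemma bin_load_hard_instance s c t b : bin_load (hard_instance s) c t b =
  (count (fun i => present (hard_instance s) t i && (c i == b))
     (iota 0 (M * M)))%:R / M%:R.
Proof.
rewrite /bin_load size_hard_instance -sum1_count natr_sum mulr_suml.
rewrite big_seq_cond [RHS]big_seq_cond; apply: eq_bigr => i.
rewrite mem_iota add0n => /andP[/= iM _].
by rewrite it_hard_instance// mul1r.
Qed.

Lemma bin_load_hard_instance_le1 s c t b : (bin_load (hard_instance s) c t b <= 1) =
  (count (fun i => present (hard_instance s) t i && (c i == b))
     (iota 0 (M * M)) <= M)%N.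
Proof. by rewrite bin_load_hard_instance ler_pdivrMr ?ltr0n// mul1r ler_nat. Qed.

(** Only the durations depend on the word, and they are positive, so no departure has revealed any
    of them at time 0. *)
Lemma same_info_hard_instance0 s s' :
  same_info (hard_instance s) (hard_instance s') 0.
Proof.
move=> i; rewrite /arrived !size_hard_instance; split.
  by case: ltnP => //= iM; rewrite !it_hard_instance.
move=> /andP[iM _]; rewrite !it_hard_instance//= !add0r.
by rewrite !leNgt !hard_dur_gt0.
Qed.

Lemma opt_at_hard_instance s t : (size s <= M)%N ->
  ((opt_at (hard_instance s) t)%:R <=
   M%:R * \1_(`[0, 1[%classic) t + 1 * \1_(`[1, (1 + L)[%classic) t :> R).
Proof.
move=> sM; have MM : (M <= M * M)%N by rewrite leq_pmulr.
have [t0|t0] := ltP t 0.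
  apply: (@le_trans _ _ 0).
    rewrite (ler_nat _ _ 0); apply: opt_at_le => //; exists (fun=> 0%N).
    split=> [i|b]; first by rewrite present_hard_instance leNgt t0 andbF.
    rewrite bin_load_hard_instance_le1 (@eq_count _ _ pred0) ?count_pred0// => i /=.
    by rewrite present_hard_instance leNgt t0 andbF.
  by rewrite addr_ge0// mulr_ge0.
have [t1|t1] := ltP t 1.
  rewrite !indicE !mem_setE !in_itv/= t0 t1 (leNgt 1 t) t1 /= mulr0 addr0 mulr1.
  rewrite ler_nat; apply: opt_at_le; last by rewrite size_hard_instance.
  (* Blocks of [M] consecutive items fill the [M] bins. *)
  exists (fun i => (i %/ M)%N); split=> [i|b].
    by rewrite present_hard_instance => /andP[iM _]; rewrite ltn_divLR.
  rewrite bin_load_hard_instance_le1 -size_filter -[leqRHS](size_iota (b * M)).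
  apply: uniq_leq_size; first by rewrite filter_uniq// iota_uniq.
  move=> i; rewrite mem_filter !mem_iota => /andP[/andP[_ /eqP <-] _].
  rewrite leq_divM /= {1}(divn_eq i M) ltn_add2l; exact: ltn_pmod.
have [tL|tL] := ltP t (1 + L).
  rewrite !indicE !mem_setE !in_itv/= t0 t1 tL (ltNge t 1) t1 /= mulr0 add0r mulr1.
  rewrite (ler_nat _ _ 1); apply: opt_at_le; last first.
    by rewrite size_hard_instance muln_gt0 M_gt0.
  (* Only letters of [s] remain, at most [M] of them, and one bin holds them all. *)
  exists (fun=> 0%N); split=> // b.
  rewrite bin_load_hard_instance_le1 (leq_trans _ sM)// -size_filter.
  apply: uniq_leq_size; first by rewrite filter_uniq// iota_uniq.
  move=> i; rewrite mem_filter present_hard_instance => /andP[/andP[/and3P[_ _]]].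
  by case: ifP => // _; rewrite ltNge t1.
apply: (@le_trans _ _ 0); last by rewrite addr_ge0// mulr_ge0.
have np i : present (hard_instance s) t i = false.
  rewrite present_hard_instance; case: ifP => _.
    by rewrite (ltNge t) tL !andbF.
  by rewrite (ltNge t) t1 !andbF.
rewrite (ler_nat _ _ 0); apply: opt_at_le => //; exists (fun=> 0%N).
split=> [i|b]; first by rewrite np.
rewrite bin_load_hard_instance_le1 (@eq_count _ _ pred0) ?count_pred0// => i /=.
by rewrite np.
Qed.

Lemma OPT_hard_instance s : (size s <= M)%N ->
  (OPT (hard_instance s) <= (M%:R + L)%:E)%E.
Proof.
move=> sM; apply: (@le_trans _ _ (\int[lebesgue_measure]_(t in [set: R])
    (M%:R * \1_(`[0, 1[%classic) t + 1 * \1_(`[1, (1 + L)[%classic) t)%:E)%E).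
  apply: le_ge0_integralT => t; first by rewrite lee_fin.
  by rewrite lee_fin opt_at_hard_instance.
under eq_integral do rewrite EFinD.
have mi (a b k : R) : measurable_fun [set: R]
    (fun t : R => (k * \1_(`[a, b[%classic) t)%:E).
  by apply/measurable_EFinP; exact: measurable_funM.
rewrite ge0_integralD//; [|exact: mi|exact: mi].
rewrite !integral_step ?lerDl// -EFinD lee_fin.
by rewrite subr0 mulr1 mul1r addrAC subrr add0r.
Qed.

Lemma cost_hard_instance s tr : {subset s <= iota 0 (M * M)} ->
  valid_traj (hard_instance s) tr ->
  ((L * (size (undup (map (config_at tr 0) s)))%:R)%:E <=
   cost (hard_instance s) tr + L%:E * (migrations (hard_instance s) tr)%:R%:E)%E.
Proof.
move=> sI tr_valid.
set D := size _; set mig := migrations _ _.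
(* Truncated subtraction keeps the lower step function nonnegative even when [mig] exceeds [D]. *)
apply: (@le_trans _ _ (((D - mig)%N%:R * L)%:E + (L * mig%:R)%:E)%E).
  rewrite -EFinD lee_fin mulrC [leRHS]addrC [L * _]mulrC -mulrDl.
  by rewrite ler_wpM2r// -natrD ler_nat -leq_subLR.
rewrite EFinM leeD2r// -EFinM.
have -> : (D - mig)%N%:R * L = (D - mig)%N%:R * (1 + L - 1).
  by rewrite addrAC subrr add0r.
rewrite -integral_step ?lerDl//; apply: le_ge0_integralT => t.
  by rewrite lee_fin mulr_ge0.
rewrite lee_fin indicE mem_setE in_itv /=.
case: andP => [[t1 tL]|_]; last by rewrite mulr0.
have t0 : 0 <= t by exact: le_trans t1.
rewrite mulr1 ler_nat leq_subLR addnC; apply: size_undup_config0_le => //.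
  by move=> i; rewrite size_hard_instance => /it_hard_instance ->.
move=> i si; rewrite mem_filter size_hard_instance (sI _ si) andbT.
have := sI _ si; rewrite mem_iota => /= iM.
by rewrite present_hard_instance iM t0 si.
Qed.

End HardInstance.

(** * Averaging over words and seeds *)

Lemma exists_ge_average (R : realType) (T : eqType) (s : seq T)
    (f : T -> \bar R) (r : R) : s != [::] ->
  ((r * (size s)%:R)%:E <= \sum_(x <- s) f x)%E ->
  exists2 x, x \in s & (r%:E <= f x)%E.
Proof.
move=> s0 avg; apply: contrapT => no.
suff : (\sum_(x <- s) f x < (r * (size s)%:R)%:E)%E by rewrite ltNge avg.
have {no avg} fr x : x \in s -> (f x < r%:E)%E.
  by move=> xs; rewrite ltNge; apply/negP => rf; apply: no; exists x.
elim: s s0 fr => // x s IH _ fr; rewrite big_cons /= mulrS mulrDr mulr1 EFinD.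
case: s IH fr => [|y s] IH fr.
  by rewrite big_nil mulr0 !adde0; apply: fr; exact: mem_head.
apply: lteD; first by apply: fr; exact: mem_head.
by apply: IH => // z zs; apply: fr; rewrite inE zs orbT.
Qed.

Section Averaging.
Context {R : realType} {d : measure_display} {Omega : measurableType d}.
Variables (P : probability Omega R) (A : Omega -> online_alg R).
Hypothesis Hmeas : rand_measurable A.
Variables (M : nat) (L : R).
Hypotheses (M_gt0 : (0 < M)%N) (L_ge0 : 0 <= L).
Local Notation inst := (hard_instance M L).

(** This supplies the capacity hypothesis of the counting argument; the empty word serves as
    reference instance. *)
Lemma count_config0_le w b :
  (count (fun i => config_at (run (A w) (inst [::])) 0 i == b)
     (iota 0 (M * M)) <= M)%N.
Proof.
have [_ _ _ /(_ 0 b)] := run_valid (A w) (hard_instance_valid M_gt0 L_ge0 [::]).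
rewrite bin_load_hard_instance_le1//; apply: leq_trans.
rewrite leq_eqVlt; apply/orP; left.
apply/eqP/eq_in_count => i; rewrite mem_iota add0n => /= iM.
by rewrite present_hard_instance iM lexx ltr01.
Qed.

(* Before time [1] the instances are indistinguishable, so the initial packing
   is the one of [inst [::]] whatever the word [s]. *)
Lemma map_config0 w s : {subset s <= iota 0 (M * M)} ->
  map (config_at (run (A w) (inst s)) 0) s =
  map (config_at (run (A w) (inst [::])) 0) s.
Proof.
move=> sI; apply/eq_in_map => i si.
apply: run_online; [exact: hard_instance_valid..|exact: same_info_hard_instance0|].
have := sI _ si; rewrite mem_iota => /= iM.
by rewrite present_hard_instance iM lexx si ltr_wpDr.
Qed.

Lemma sum_cost_migrations_ge w :
  ((L * M.+1%:R / 2 * (size (words (M * M) M))%:R)%:E <=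
   \sum_(s <- words (M * M) M)
     (cost (inst s) (run (A w) (inst s)) +
      L%:E * (migrations (inst s) (run (A w) (inst s)))%:R%:E))%E.
Proof.
have := double_sum_undup_words M_gt0 (count_config0_le w).
set c := config_at _ _ => H.
apply: (@le_trans _ _
  (\sum_(s <- words (M * M) M) (L * (size (undup (map c s)))%:R)%:E)%E).
  rewrite sumEFin lee_fin -mulr_sumr -natr_sum size_words -!mulrA.
  rewrite ler_wpM2l// mulrCA mulrC ler_pdivrMr// -!natrM ler_nat.
  by rewrite mulnC [leqRHS]mulnC.
rewrite big_seq [leRHS]big_seq; apply: lee_sum => s /words_spec[_ sI].
rewrite /c -map_config0//; apply: cost_hard_instance => //.
by apply: run_valid; exact: hard_instance_valid.
Qed.

(** Yao's principle: the bound summed over words holds for every seed, so it survives integration,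
    and some fixed word attains the average. *)
Lemma exists_E_cost_E_mig_ge : exists2 s, s \in words (M * M) M &
  ((L * M.+1%:R / 2)%:E <= E_cost P A (inst s) + L%:E * E_mig P A (inst s))%E.
Proof.
apply: exists_ge_average.
  by rewrite -size_eq0 size_words expn_eq0 muln_eq0; lia.
set r := _ * _.
have mf s : measurable_fun [set: Omega]
    (fun w => L%:E * (migrations (inst s) (run (A w) (inst s)))%:R%:E)%E.
  have [_ mm] := Hmeas (hard_instance_valid M_gt0 L_ge0 s).
  by apply: measurable_funeM; apply/measurable_EFinP.
have c0 s w : (0 <= cost (inst s) (run (A w) (inst s)))%E.
  by apply: integral_ge0 => t _; rewrite lee_fin.
have m0 s w : (0 <= L%:E * (migrations (inst s) (run (A w) (inst s)))%:R%:E)%E.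
  by rewrite mule_ge0 ?lee_fin.
have mc s := (Hmeas (hard_instance_valid M_gt0 L_ge0 s)).1.
have -> : (\sum_(s <- words (M * M) M)
      (E_cost P A (inst s) + L%:E * E_mig P A (inst s)) =
    \int[P]_w \sum_(s <- words (M * M) M)
      (cost (inst s) (run (A w) (inst s)) +
      L%:E * (migrations (inst s) (run (A w) (inst s)))%:R%:E))%E.
  rewrite ge0_integral_sum//; last 2 first.
  - by move=> s; exact: emeasurable_funD.
  - by move=> s w _; rewrite adde_ge0.
  apply: eq_bigr => s _; rewrite ge0_integralD// ge0_integralZl_EFin//.
  by apply/measurable_EFinP; exact: (Hmeas (hard_instance_valid M_gt0 L_ge0 s)).2.
have r0 : 0 <= r by rewrite /r !mulr_ge0.
have -> : (r%:E = \int[P]_w (cst r%:E) w)%E.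
  by rewrite integral_cst// [X in (_ * X)%E]probability_setT mule1.
apply: le_ge0_integralT => w /=; first by rewrite lee_fin.
exact: sum_cost_migrations_ge.
Qed.

Lemma exists_hard_instance (alpha : R) :
  (forall I : instance R, valid_instance I ->
     (E_mig P A I <= (alpha * (size I)%:R)%:E)%E) ->
  exists2 s, size s = M &
    ((L * (M.+1%:R / 2 - alpha * (M * M)%:R))%:E <= E_cost P A (inst s))%E.
Proof.
move=> Hmig; have [s /words_spec[sM _] Hs] := exists_E_cost_E_mig_ge.
exists s => //; rewrite mulrBr EFinB leeBlDr// mulrA (le_trans Hs)// leeD2l//.
rewrite EFinM lee_wpmul2l ?lee_fin// -(size_hard_instance M L s).
by apply: Hmig; exact: hard_instance_valid.
Qed.

End Averaging.

Theorem theorem3 (R : realType) (alpha : R) (halpha : 0 < alpha < 1)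
  (d : measure_display) (Omega : measurableType d) (P : probability Omega R)
  (A : Omega -> online_alg R)
  (Hmeas : rand_measurable A)
  (Hmig : forall I : instance R, valid_instance I ->
     (E_mig P A I <= (alpha * (size I)%:R)%:E)%E) :
  competitive_ratio_at_least P A ((Num.floor (4 * alpha)^-1)%:~R / 4).
Proof.
move=> beta; set F := Num.floor _ => hbeta.
have /andP[alpha0 alpha1] := halpha.
have F0 : 0 <= F by rewrite floor_ge0 invr_ge0 mulr_ge0// ltW.
have F_le : F%:~R <= (4 * alpha)^-1 := ge_floor _.
case: F F0 hbeta F_le => // m _; rewrite -!pmulrn => hbeta m_le.
pose M := maxn m 1; have M0 : (0 < M)%N by rewrite leq_max orbT.
(* When [alpha * M <= 1 / 4], the goal reduces to [M ^ 2 / 4 < L / 2]. *)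
pose L : R := M%:R ^+ 2; have L0 : 0 <= L by rewrite exprn_ge0.
have [s sM Hs] := exists_hard_instance Hmeas M0 L0 Hmig.
exists (hard_instance M L s); split; first exact: hard_instance_valid.
have OPT_le : (OPT (hard_instance M L s) <= (M%:R + L)%:E)%E.
  by apply: OPT_hard_instance => //; rewrite sM.
have OPT_ge0 : (0 <= OPT (hard_instance M L s))%E.
  by apply: integral_ge0 => t _; rewrite lee_fin.
apply: lt_le_trans Hs.
(* Multiplying by [OPT], known only to be nonnegative, preserves weak inequalities; strictness comes
   from the slack in [L]. *)
have bm : beta <= m%:R / 4 by exact: ltW.
apply: (@le_lt_trans _ _ ((m%:R / 4)%:E * (M%:R + L)%:E)%E).
  apply: (@le_trans _ _ ((m%:R / 4)%:E * OPT (hard_instance M L s))%E).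
    by rewrite lee_wpmul2r// lee_fin.
  by rewrite lee_wpmul2l// lee_fin divr_ge0.
rewrite -EFinM lte_fin /L natrM -(natr1 M).
(* If [m = 0], then [M = L = 1] and the claim is [0 < 1 - alpha]. *)
have [m0|m0] := posnP m.
  by rewrite /M m0 max0n !mul0r expr1n; lra.
have -> : M = m by apply/maxn_idPl.
have am : alpha * m%:R <= 1 / 4.
  have := ler_wpM2l (ltW alpha0) m_le; rewrite invfM mulrCA mulfV ?gt_eqF//.
  by rewrite mulr1 div1r.
have : 1 <= m%:R :> R by rewrite ler1n.
move: m%:R am => x am x1.
have x0 : 0 < x by lra.
(* The factor [x ^ 3] produces the monomial [alpha * x ^ 4] of the goal, which is then linear in the
   monomials, with a margin of [x ^ 2 / 4]. *)
have := ler_wpM2l (exprn_ge0 3 (ltW x0)) am; have := exprn_gt0 2 x0.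
rewrite !exprS expr0; lra.
Qed.
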